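(* Let $k \geq 3$ be an integer, let $n$ be an integer with $n \geq \binom{k}{2} + k + 1$, and let $m = \binom{\binom{k}{2}+2}{2} - 1$. Then there does not exist an optimally-least graph for the $k$-independence polynomial of order $n$ and size $m$; that is, there is no $H \in \mathcal{S}_{n,m}$ such that $I_k(H,x) \leq I_k(G,x)$ for all $G \in \mathcal{S}_{n,m}$ and all real $x \geq 0$.
   Context: All graphs are finite and simple. $\mathcal{S}_{n,m}$ denotes the set of simple graphs with $n$ vertices (order $n$) and $m$ edges (size $m$). For fixed $k \geq 2$, the $k$-independence polynomial of a graph $G$ is $I_k(G,x) = \sum_j i_{k,j} x^j$, where $i_{k,j}$ is the number of subsets of the vertex set of $G$ of cardinality $j$ that induce a subgraph containing no complete subgraph of order $k$ (including the empty set). *)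

(* Defs.v *)
From mathcomp Require Import all_boot all_order all_algebra.
From mathcomp Require Import reals.

Set Implicit Arguments.
Unset Strict Implicit.
Unset Printing Implicit Defensive.

Import GRing.Theory Num.Theory.
Local Open Scope ring_scope.

Record sgraph : Type := SGraph {
  vertex :> finType;
  adj : rel vertex;
  adj_sym : symmetric adj;
  adj_irrefl : irreflexive adj }.

Definition edges (G : sgraph) : {set {set G}} :=
  [set e : {set G} | [exists x : G, exists y : G, adj x y && (e == [set x; y])]].

(* Membership in S_{n,m}; the vertex set may be any finite type, so graphs of
   the same order may live on different vertex types. *)
Definition in_S (n m : nat) (G : sgraph) : Prop :=
  #|G| = n /\ #|edges G| = m.

Definition complete_on (G : sgraph) (K : {set G}) : bool :=
  [forall x in K, forall y in K, (x != y) ==> adj x y].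

Definition k_independent (k : nat) (G : sgraph) (A : {set G}) : bool :=
  ~~ [exists K : {set G}, [&& K \subset A, #|K| == k & complete_on K]].

Definition num_k_independent (k j : nat) (G : sgraph) : nat :=
  #|[set A : {set G} | k_independent k A & #|A| == j]|.

Definition k_indep_poly (R : realType) (k : nat) (G : sgraph) : {poly R} :=
  \poly_(j < #|G|.+1) (num_k_independent k j G)%:R.

Definition optimally_least (R : realType) (k n m : nat) (H : sgraph) : Prop :=
  in_S n m H /\
  forall G : sgraph, in_S n m G ->
  forall x : R, 0 <= x -> (k_indep_poly R k H).[x] <= (k_indep_poly R k G).[x].

(* Main.v *)
Require Import Defs.
From mathcomp Require Import all_boot all_order all_algebra.
From mathcomp Require Import reals.
From mathcomp Require Import polyrcf zify lra.

(** Write q = 'C(k, 2) + 2, so that m = 'C(q, 2) - 1. Two graphs of order n and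
    size m make incompatible demands on an optimally-least graph H.

    Near x = 0 the comparison is decided by the first coefficient that depends
    on the graph, the one of degree k, which equals 'C(n, k) minus the number of
    k-cliques ([num_k_independent_eq], [first_coef_ge0]). Hence H has at least
    as many k-cliques as the complete graph on q vertices minus one edge
    ([clique_count_almost_complete]). That graph has the maximum number of
    k-cliques for its size ([kruskal_katona]), and the equality case is rigid
    enough to give H a k-independent set of n - q + k vertices
    ([near_extremal_k_independent]).

    As x grows, the comparison is decided by the degree, which is the largest
    cardinality of a k-independent set ([lead_coef_ge0]). The disjoint union of
    complete graphs on q - 1 and on k vertices also has
    'C(q - 1, 2) + 'C(k, 2) = 'C(q - 1, 2) + (q - 2) = m edges, and it fits into
    n >= q - 1 + k vertices. Its k-independent sets have at most n - q + k - 1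
    vertices ([k_independent_two_cliques]), because each clique contributes at
    most k - 1. So the polynomial of H eventually exceeds that of this graph.
*)

Set Implicit Arguments.
Unset Strict Implicit.
Unset Printing Implicit Defensive.

Import Order.TTheory GRing.Theory Num.Theory.

(** * Convexity of binomial coefficients *)

(** Convexity of 'C(-, j): among pairs with a given sum, the value at the most
    spread out pair is the largest. *)
Lemma bin_convex j x s t :
  'C(x + s, j) + 'C(x + t, j) <= 'C(x, j) + 'C(x + s + t, j).
Proof.
elim: t j => [|t IHt] j; first by rewrite !addn0 addnC.
case: j => [|j]; first by rewrite !bin0.
rewrite !addnS !binS.
have := IHt j.+1.
have : 'C(x + t, j) <= 'C(x + s + t, j) by apply: leq_bin2l; lia.
lia.
Qed.

(** Count the j-subsets of a disjoint union of parts of sizes s and t: those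
    inside one part give the left side, and since 1 < j some j-subset meets
    both parts. The proof peels one element off the first part. *)
Lemma bin_superadd_lt j s t : 1 < j -> j <= s + t -> 0 < s -> 0 < t ->
  'C(s, j) + 'C(t, j) < 'C(s + t, j).
Proof.
case: j => [|[|j]] // _; case: s => [|s] // jst _ t0.
rewrite addSn !binS.
have := bin_convex j.+2 0 s t; rewrite bin0n !add0n.
suff: 'C(s, j.+1) < 'C(s + t, j.+1) by lia.
case: (leqP j s) => [js|sj]; last by rewrite (bin_small (n:=s)) ?bin_gt0; lia.
apply: (@leq_trans 'C(s.+1, j.+1)); last by apply: leq_bin2l; lia.
by rewrite binS -addn1 leq_add2l bin_gt0.
Qed.

(** * Clique counts inside a vertex set *)
Section Cliques.
Variable G : sgraph.
Implicit Types (S K : {set G}) (u v : G) (j : nat).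

Definition nbr v : {set G} := [set u | adj v u].

Definition cliques j S : {set {set G}} :=
  [set K : {set G} | [&& K \subset S, #|K| == j & complete_on K]].

Definition clique_count j S : nat := #|cliques j S|.

Lemma complete_onP K :
  reflect {in K &, forall x y, x != y -> adj x y} (complete_on K).
Proof.
apply: (iffP forallP) => [h x y xK yK xy | h x].
  by have /implyP/(_ xK)/forallP/(_ y)/implyP/(_ yK)/implyP/(_ xy) := h x.
apply/implyP => xK; apply/forallP => y; apply/implyP => yK; apply/implyP.
exact: h.
Qed.

(** Edges are the 2-cliques, so the recursions below treat the number of edges
    and the number of k-cliques in the same way. *)
Lemma edgesE : edges G = cliques 2 setT.
Proof.
apply/setP => e; rewrite !inE subsetT /=; apply/existsP/andP => [[x /existsP[y]]|].
  case/andP => xy /eqP->; rewrite cards2.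
  have xNy : x != y by apply: contraTneq xy => ->; rewrite adj_irrefl.
  rewrite xNy; split=> //; apply/complete_onP => u w; rewrite !inE.
  case/orP => /eqP-> /orP[] /eqP->; rewrite ?eqxx // => _ //.
  by rewrite adj_sym.
case=> /cards2P[x [y [xNy ->]]] /complete_onP h; exists x; apply/existsP; exists y.
by rewrite eqxx andbT h // !inE eqxx ?orbT.
Qed.

Lemma clique_count_le_bin j S : clique_count j S <= 'C(#|S|, j).
Proof.
rewrite /clique_count -cards_draws; apply: subset_leq_card; apply/subsetP => K.
by rewrite !inE => /and3P[-> ->].
Qed.

Lemma cliquesS j S S' : S \subset S' -> cliques j S \subset cliques j S'.
Proof.
move=> SS'; apply/subsetP => K; rewrite !inE => /and3P[KS -> ->].
by rewrite (subset_trans KS SS').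
Qed.

Lemma clique_count_complete j S :
  {in S &, forall x y, x != y -> adj x y} -> clique_count j S = 'C(#|S|, j).
Proof.
move=> h; rewrite /clique_count -cards_draws; apply: eq_card => K; rewrite !inE.
apply/and3P/andP => [[-> ->]//|[KS ->]]; split=> //; apply/complete_onP => x y xK yK.
by apply: h; apply: (subsetP KS).
Qed.

Lemma clique_count1 S : clique_count 1 S = #|S|.
Proof.
rewrite -[RHS]bin1 -cards_draws /clique_count; apply: eq_card => K; rewrite !inE.
apply/and3P/andP => [[-> ->]//|[KS /[dup] K1 ->]]; split=> //.
case/cards1P: K1 => x ->; apply/complete_onP => y z.
by rewrite !inE => /eqP-> /eqP->; rewrite eqxx.
Qed.

(** The cliques through v correspond, by removing v, to the cliques one
    smaller inside the neighbourhood of v. *)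
Lemma clique_count_delete j S v : v \in S ->
  clique_count j.+1 S = clique_count j.+1 (S :\ v) + clique_count j (S :&: nbr v).
Proof.
move=> vS; rewrite [LHS]/clique_count -(cardsID [set K : {set G} | v \in K]) addnC.
congr (_ + _).
  by apply: eq_card => K; rewrite !inE subsetD1; case: (v \in K); rewrite /= ?andbF ?andbT.
have vN K : K \subset S :&: nbr v -> v \notin K.
  move=> KS; apply/negP => /(subsetP KS); rewrite !inE adj_irrefl andbF //.
have vinj : {in cliques j (S :&: nbr v) &, injective (fun K => v |: K)}.
  move=> K L; rewrite !inE => /and3P[KS _ _] /and3P[LS _ _] KL.
  by rewrite -(setU1K (vN K KS)) KL (setU1K (vN L LS)).
rewrite [clique_count j _]/clique_count -(card_in_imset vinj).
apply: eq_card => K; rewrite !inE; apply/andP/imsetP.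
  case=> /and3P[KS /eqP cK /complete_onP hK] vK; exists (K :\ v); last by rewrite setD1K.
  rewrite inE; apply/and3P; split.
  - apply/subsetP => x; rewrite !inE => /andP[xv xK]; rewrite (subsetP KS) //=.
    by apply: hK; rewrite // eq_sym.
  - by move: cK; rewrite (cardsD1 v) vK add1n => -[->].
  - apply/complete_onP => x y; rewrite !inE => /andP[_ xK] /andP[_ yK]; exact: hK.
case=> L; rewrite inE => /and3P[LS /eqP cL /complete_onP hL] ->.
rewrite setU11; split=> //; apply/and3P; split.
- by rewrite subUset sub1set vS (subset_trans LS) ?subsetIl.
- by rewrite cardsU1 vN // cL.
apply/complete_onP => x y; rewrite !inE.
case/orP => [/eqP->|xL] /orP[/eqP->|yL]; rewrite ?eqxx // => xy.
- by have := subsetP LS _ yL; rewrite !inE => /andP[].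
- by have := subsetP LS _ xL; rewrite !inE adj_sym => /andP[].
- exact: hL.
Qed.

Lemma edge_count_delete S v : v \in S ->
  clique_count 2 S = clique_count 2 (S :\ v) + #|S :&: nbr v|.
Proof. by move=> vS; rewrite (clique_count_delete _ vS) clique_count1. Qed.

(** Delete one vertex: this loses at least d edges, and every remaining degree
    drops by at most 1, so induction on d applies. *)
Lemma min_degree_edges d S : 0 < #|S| ->
  {in S, forall v, d <= #|S :&: nbr v|} -> 'C(d.+1, 2) <= clique_count 2 S.
Proof.
elim: d S => [|d IHd] S S0 hS; first by rewrite bin_small.
have [u uS] := card_gt0P S0.
have du := hS u uS.
rewrite (edge_count_delete uS) binS bin1; apply: leq_add (du).
apply: IHd.
  have /card_gt0P[w] : 0 < #|S :&: nbr u| by exact: leq_ltn_trans du.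
  rewrite !inE => /andP[wS uw]; apply/card_gt0P; exists w; rewrite !inE wS andbT.
  by apply: contraTneq uw => ->; rewrite adj_irrefl.
move=> v; rewrite !inE => /andP[vu vS]; have := hS v vS.
rewrite setIDAC (cardsD1 u (S :&: nbr v)); case: (u \in _); lia.
Qed.

Lemma exists_min_degree S : 0 < #|S| ->
  exists2 v, v \in S & {in S, forall u, #|S :&: nbr v| <= #|S :&: nbr u|}.
Proof.
case/card_gt0P => x xS.
by case: (arg_minnP (fun v => #|S :&: nbr v|) xS) => v vS h; exists v.
Qed.

(** * The Kruskal-Katona bound for cliques and its near-equality case *)

(** A complete graph on a vertices together with a vertex joined to b of them
    maximises the number of k-cliques for its number of edges. Delete a vertex
    of minimum degree d: it lies in at most 'C(d, k.-1) of the k-cliques, and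
    the induction hypothesis bounds the others, with b - d in place of b if
    d <= b, and with a - 1 and a - 1 + b - d in place of a and b otherwise. In
    both cases the total stays below the target by convexity of binomials;
    the degree is small enough because minimum degree d forces 'C(d.+1, 2)
    edges. *)
Lemma kruskal_katona k a b S : 1 < k -> b <= a ->
  clique_count 2 S <= 'C(a, 2) + b -> clique_count k S <= 'C(a, k) + 'C(b, k.-1).
Proof.
case: k => // k k0; rewrite /= ltnS in k0 *.
have [N] := ubnP #|S|; elim: N S a b => // N IHN S a b SN ba mS.
have [S0|S0] := posnP #|S|.
  by apply: leq_trans (clique_count_le_bin _ _) _; rewrite S0 bin0n.
have [v vS vmin] := exists_min_degree S0.
have SvN : #|S :\ v| < N by move: SN; rewrite (cardsD1 v S) vS; lia.
have dm := min_degree_edges S0 vmin.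
have := mS; rewrite (edge_count_delete vS) (clique_count_delete _ vS).
have := clique_count_le_bin k (S :&: nbr v).
move: dm; move: #|S :&: nbr v| => d dm Nk mv.
have [db|bd] := leqP d b.
  have {}h : clique_count k.+1 (S :\ v) <= 'C(a, k.+1) + 'C(b - d, k) by apply: IHN => //; lia.
  have := bin_convex k 0 (b - d) d; rewrite bin0n !add0n subnK //.
  by case: k k0 {IHN} Nk h => //= k _; lia.
have da : d < a.
  rewrite ltnNge; apply/negP => ad.
  have : 'C(a.+1, 2) <= 'C(d.+1, 2) by apply: leq_bin2l.
  rewrite binS bin1 => h; have ab : a = b by lia.
  have : 'C(b.+2, 2) <= 'C(d.+1, 2) by apply: leq_bin2l.
  by rewrite !binS !bin1 !bin0 ab in dm mS *; lia.
(* The deletion also consumes edges at the last vertex of the a-clique. *)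
case: a ba mS da mv => // a ba mS da mv.
rewrite !binS bin1 in mv *.
have h : clique_count k.+1 (S :\ v) <= 'C(a, k.+1) + 'C(a + b - d, k).
  by apply: IHN => //; lia.
have := bin_convex k b (d - b) (a - d).
have -> : b + (d - b) = d by lia.
have -> : b + (a - d) = a + b - d by lia.
have -> : d + (a - d) = a by lia.
lia.
Qed.

(** Cliques with at least two vertices avoid isolated vertices. *)
Lemma clique_has_nbr K x : 1 < #|K| -> complete_on K -> x \in K ->
  exists2 y, y \in K & adj x y.
Proof.
move=> K1 /complete_onP hK xK.
have : 0 < #|K :\ x| by move: K1; rewrite (cardsD1 x) xK.
case/card_gt0P => y; rewrite !inE => /andP[yx yK]; exists y => //.
by apply: hK; rewrite // eq_sym.
Qed.

Lemma clique_count_isolated j S S' : 1 < j -> S' \subset S ->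
  {in S :\: S', forall v, S :&: nbr v = set0} -> clique_count j S = clique_count j S'.
Proof.
move=> j1 S'S iso; apply: eq_card => K; rewrite !inE.
apply/and3P/and3P => [[KS /eqP cK hK]|[KS cK hK]]; split=> //; first 2 last.
- exact: subset_trans S'S.
- apply/subsetP => x xK; have [|y yK xy] := clique_has_nbr _ hK xK; first by rewrite ?cK.
  apply: contraT => xS'; have /setP/(_ y) : S :&: nbr x = set0.
    by apply: iso; rewrite inE xS' (subsetP KS).
  by rewrite !inE (subsetP KS) // xy.
by rewrite cK.
Qed.

Lemma exists_subset_card (A : {set G}) j : j <= #|A| ->
  exists2 B : {set G}, B \subset A & #|B| = j.
Proof.
rewrite -bin_gt0 -cards_draws => /card_gt0P[B].
by rewrite inE => /andP[BA /eqP cB]; exists B.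
Qed.

(** If all j-subsets of S are cliques then so is S, because any two vertices of
    S lie in a common j-subset. *)
Lemma complete_of_clique_count j S : 1 < j <= #|S| -> 'C(#|S|, j) <= clique_count j S ->
  {in S &, forall x y, x != y -> adj x y}.
Proof.
case/andP=> j1 jS; rewrite -cards_draws => h x y xS yS xy.
have cxy : #|[set x; y]| = 2 by rewrite cards2 xy.
have sxy : [set x; y] \subset S by rewrite subUset !sub1set xS.
have [|B BS cB] := @exists_subset_card (S :\: [set x; y]) (j - 2).
  by rewrite cardsD (setIidPr sxy) cxy leq_sub2r.
have sub : cliques j S \subset [set K : {set G} | K \subset S & #|K| == j].
  by apply/subsetP => K; rewrite !inE => /and3P[-> ->].
have /setP/(_ ([set x; y] :|: B)) : cliques j S = [set K : {set G} | K \subset S & #|K| == j].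
  by apply/eqP; rewrite eqEcard sub.
have -> : [set x; y] :|: B \in [set K : {set G} | K \subset S & #|K| == j].
  rewrite inE subUset sxy (subset_trans BS) ?subsetDl //= cardsU cxy cB.
  have -> : [set x; y] :&: B = set0.
    by apply/eqP; rewrite setI_eq0 disjoint_sym; move: BS; rewrite subsetD => /andP[].
  by rewrite cards0 subn0 subnKC.
rewrite inE => /and3P[_ _ /complete_onP]; apply=> //; by rewrite !inE eqxx ?orbT.
Qed.

Lemma k_independentE k (A : {set G}) : k_independent k A = (cliques k A == set0).
Proof.
rewrite -[RHS]negbK; congr (~~ _); apply/existsP/set0Pn => -[K hK]; exists K.
  by rewrite inE.
by rewrite inE in hK.
Qed.

Lemma k_independent_meet k (A C : {set G}) : k_independent k A ->
  {in C &, forall x y, x != y -> adj x y} -> #|A :&: C| < k.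
Proof.
rewrite k_independentE => /eqP iA hC; rewrite ltnNge; apply/negP.
case/exists_subset_card => K; rewrite subsetI => /andP[KA KC] cK.
have /setP/(_ K) := iA; rewrite !inE KA cK eqxx /= => /negbT/negP[].
by apply/complete_onP => x y xK yK; apply: hC; apply: (subsetP KC).
Qed.

(** The numerical hypotheses refer to a complete graph on b.+2 vertices minus
    one edge. The argument of [kruskal_katona] is then tight: strict superadditivity
    forces the minimum degree d over the non-isolated vertices to be b, so a
    vertex v of minimum degree has all the 'C(b, k.-1) possible k-cliques
    through it and its closed neighbourhood C is a clique on b.+1 vertices.
    Only b edges leave C, while each non-isolated vertex outside C needs b of
    them, so there is at most one such vertex, and it is not adjacent to v.
    Deleting all but k - 2 of the neighbours of v therefore destroys every
    k-clique. *)
Lemma near_extremal_k_independent k b : 2 < k -> k.-1 <= b ->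
  clique_count 2 [set: G] = 'C(b.+1, 2) + b ->
  'C(b.+1, k) + 'C(b, k.-1) <= clique_count k [set: G] ->
  exists2 A : {set G}, k_independent k A & #|A| + b + 2 = #|G| + k.
Proof.
case: k => [|[|k]] //= k2 kb m2 mk.
pose S := [set v : G | nbr v != set0].
have iso : {in [set: G] :\: S, forall v, [set: G] :&: nbr v = set0}.
  by move=> v; rewrite !inE andbT negbK setTI => /eqP.
have nS j : 1 < j -> clique_count j [set: G] = clique_count j S.
  by move=> j1; apply: clique_count_isolated iso; rewrite ?subsetT.
have nbrS v : nbr v \subset S.
  apply/subsetP => u; rewrite !inE => vu; apply/set0Pn; exists v.
  by rewrite inE adj_sym.
rewrite !nS // in m2 mk.
have S0 : 0 < #|S|.
  rewrite lt0n; apply/eqP => S0; have := clique_count_le_bin 2 S.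
  by rewrite S0 m2 bin0n; lia.
have [v vS vmin] := exists_min_degree S0.
have dm := min_degree_edges S0 vmin.
have d0 : 0 < #|S :&: nbr v|.
  by rewrite (setIidPr (nbrS v)) card_gt0; move: vS; rewrite inE.
have := clique_count_le_bin k.+1 (S :&: nbr v).
have e2 := edge_count_delete vS; have ek := clique_count_delete k.+1 vS.
(* Without v there are 'C(b.+1, 2) + (b - d) edges, d being the degree of v. *)
have KK : #|S :&: nbr v| <= b ->
    clique_count k.+2 (S :\ v) <= 'C(b.+1, k.+2) + 'C(b - #|S :&: nbr v|, k.+1).
  by move=> db; apply: kruskal_katona => //; lia.
have db : #|S :&: nbr v| <= b.
  rewrite leqNgt; apply/negP => bd.
  have : 'C(b.+2, 2) <= 'C(#|S :&: nbr v|.+1, 2) by apply: leq_bin2l.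
  by rewrite binS bin1; lia.
move/(_ db): KK => KK Nk.
(* For 0 < d < b the bounds on both parts add up to less than required. *)
have {db} db : #|S :&: nbr v| = b.
  apply/eqP; rewrite eqn_leq db leqNgt; apply/negP => bd.
  have := @bin_superadd_lt k.+1 (b - #|S :&: nbr v|) #|S :&: nbr v|.
  by rewrite subnK //; lia.
rewrite db in d0 e2 Nk KK vmin; rewrite subnn bin0n /= addn0 in KK.
set N := S :&: nbr v in db ek Nk e2.
have NC : {in N &, forall x y, x != y -> adj x y}.
  by apply: (@complete_of_clique_count k.+1); rewrite db; lia.
have NE x : (x \in N) = adj v x by rewrite /N (setIidPr (nbrS v)) inE.
have vN : v \notin N by rewrite NE adj_irrefl.
set C := v |: N.
have cC : #|C| = b.+1 by rewrite cardsU1 vN db.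
have CC : {in C &, forall x y, x != y -> adj x y}.
  move=> x y; rewrite !in_setU1 => /orP[/eqP->|xN] /orP[/eqP->|yN]; rewrite ?eqxx // => xy.
  - by rewrite -NE.
  - by rewrite adj_sym -NE.
  - exact: NC.
have CS : C \subset S by rewrite subUset sub1set vS subsetIl.
have nC : clique_count 2 C = 'C(b.+1, 2) by rewrite clique_count_complete ?cC.
(* Two vertices outside C would account for b + (b - 1) edges not in C. *)
have Y1 : #|S :\: C| <= 1.
  rewrite leqNgt; apply/negP => /card_gt1P[u [w [uY wY uw]]].
  move: uY wY; rewrite !(in_setD _ C) => /andP[uC uS] /andP[wC wS].
  have wS' : w \in S :\ u by rewrite in_setD1 eq_sym uw wS.
  have := edge_count_delete uS; have := edge_count_delete wS'.
  have : clique_count 2 C <= clique_count 2 (S :\ u :\ w).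
    by apply/subset_leq_card/cliquesS; rewrite !subsetD1 CS uC wC.
  have := vmin u uS; have := vmin w wS.
  rewrite setIDAC (cardsD1 u (S :&: nbr w)); case: (u \in _); lia.
have [|P PN cP] := @exists_subset_card N k; first by rewrite db; lia.
exists (~: (N :\: P)); last first.
  have : #|N :\: P| + #|~: (N :\: P)| = #|G| by exact: cardsC.
  rewrite cardsD (setIidPr PN) cP db => <-; move: #|~: _|; lia.
rewrite k_independentE; apply/set0Pn => -[K]; rewrite inE => /and3P[KA /eqP cK hK].
have KS : K \subset S.
  apply/subsetP => x xK; have [|y _ xy] := clique_has_nbr _ hK xK; first by rewrite cK.
  by rewrite inE; apply/set0Pn; exists y; rewrite inE.
have KPY : K \subset (v |: P) :|: (S :\: C).
  apply/subsetP => x xK; have := subsetP KA _ xK; have := subsetP KS _ xK.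
  rewrite !inE -!NE => -> ; case: (x \in P); case: (x == v); case: (x \in N) => //.
(* K is too large to avoid v, or to avoid the vertex outside C. *)
have vK : v \in K.
  apply: contraT => vK; have : K \subset P :|: (S :\: C).
    apply/subsetP => x xK; have := subsetP KPY _ xK.
    by rewrite !inE; case: eqP xK vK => [-> -> //|].
  by move/subset_leq_card; rewrite cardsU cP cK; lia.
have : ~~ (K \subset v |: P).
  apply/negP => /subset_leq_card; rewrite cardsU1 cP cK; lia.
case/subsetPn => y yK yP; have := subsetP KPY _ yK.
rewrite in_setU (negPf yP) in_setD in_setU1 negb_or NE /= -andbA.
case/and3P => yv vy _; move: vy.
by move/complete_onP/(_ v y vK yK): hK => -> //; rewrite eq_sym.
Qed.
End Cliques.

(** * Coefficients of the k-independence polynomial *)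
Lemma k_independent_card_lt k (G : sgraph) (A : {set G}) :
  #|A| < k -> k_independent k A.
Proof.
move=> Ak; rewrite k_independentE -subset0; apply/subsetP => K; rewrite !inE.
by case/and3P => /subset_leq_card KA /eqP cK _; move: Ak; rewrite -cK ltnNge KA.
Qed.

Lemma num_k_independent_lt k j (G : sgraph) : j < k ->
  num_k_independent k j G = 'C(#|G|, j).
Proof.
move=> jk; rewrite -cardsT -cards_draws; apply: eq_card => A.
rewrite !inE subsetT /=; apply: andb_idl => /eqP cA.
by apply: k_independent_card_lt; rewrite cA.
Qed.

Lemma k_independent_card_eq k (G : sgraph) (A : {set G}) :
  #|A| = k -> k_independent k A = ~~ complete_on A.
Proof.
move=> cA; rewrite k_independentE; apply/eqP/idP => [/setP/(_ A)|].
  by rewrite !inE subxx cA eqxx /= => ->.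
move=> nA; apply/setP => K; rewrite !inE; apply: contraNF nA.
case/and3P => KA /eqP cK; suff -> : K = A by [].
by apply/eqP; rewrite eqEcard KA cA cK /=.
Qed.

Lemma num_k_independent_eq k (G : sgraph) :
  num_k_independent k k G + clique_count k [set: G] = 'C(#|G|, k).
Proof.
rewrite -cardsT -cards_draws addnC -(cardsID [set A : {set G} | complete_on A]).
congr (_ + _); apply: eq_card => A; rewrite !inE subsetT //=.
by apply: andb_id2r => /eqP; apply: k_independent_card_eq.
Qed.

Lemma coef_k_indep_poly (R : realType) k (G : sgraph) j :
  ((k_indep_poly R k G)`_j = (num_k_independent k j G)%:R)%R.
Proof.
rewrite coef_poly; case: ltnP => // Gj; rewrite /num_k_independent.
rewrite (_ : [set A | _] = set0) ?cards0 //; apply/setP => A; rewrite !inE.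
apply/negP => /andP[_ /eqP cA]; move: Gj; rewrite -cA ltnNge max_card //.
Qed.

(** * Signs of the extreme coefficients of a nonnegative polynomial *)
Section PolySign.
Local Open Scope ring_scope.
Variable R : rcfType.
Implicit Type p : {poly R}.

(** The quotient p.[x] / x ^+ k tends to p`_k as x decreases to 0. *)
Lemma first_coef_ge0 p k : (forall i, (i < k)%N -> p`_i = 0) ->
  (forall x, 0 <= x -> 0 <= p.[x]) -> 0 <= p`_k.
Proof.
move=> p0 ppos; rewrite leNgt; apply/negP => pk0.
pose r := drop_poly k.+1 p.
have pE : p = r * 'X^(k.+1) + (p`_k)%:P * 'X^k.
  apply/polyP => i; rewrite coefD coefMXn coefCM coefXn coef_drop_poly ltnS.
  case: (ltngtP i k) => [ik|ki|->]; rewrite ?mulr0 ?mulr1 ?addr0 ?add0r //.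
    exact: p0.
  by rewrite subnK.
have [M hM] := poly_disk_bound r 1.
have M0 : 0 <= M by apply: le_trans (hM 0 _); rewrite ?normr0.
(* Any x in (0, 1] with x * M < - p`_k contradicts the sign of p.[x]. *)
pose x := - p`_k / (M + 1 - p`_k).
have D0 : 0 < M + 1 - p`_k by lra.
have x0 : 0 < x by rewrite divr_gt0 // oppr_gt0.
have x1 : x <= 1 by rewrite ler_pdivrMr // mul1r; lra.
have xM : x * M < - p`_k.
  rewrite /x mulrAC ltr_pdivrMr // ltr_pM2l ?oppr_gt0 //; lra.
have rM : r.[x] <= M by apply: le_trans (ler_norm _) (hM _ _); rewrite ger0_norm // ltW.
have := ppos x (ltW x0).
rewrite pE hornerD !hornerM !hornerXn hornerC exprS mulrA -mulrDl.
rewrite pmulr_lge0 ?exprn_gt0 // leNgt => /negP[].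
have : r.[x] * x <= M * x by rewrite ler_wpM2r // ltW.
by rewrite -ltrBrDr sub0r => h; apply: le_lt_trans h _; rewrite mulrC.
Qed.

Lemma lead_coef_ge0 p : (forall x, 0 <= x -> 0 <= p.[x]) -> 0 <= lead_coef p.
Proof.
move=> ppos; rewrite leNgt; apply/negP => lp.
have [|x0 hx] := @poly_pinfty_gt_lc _ (- p); first by rewrite lead_coefN oppr_gt0.
have := hx (Num.max x0 0); rewrite le_max lexx => /(_ isT).
rewrite hornerN lead_coefN lerN2 leNgt => /negP[]; apply: lt_le_trans lp _.
by apply: ppos; rewrite le_max lexx orbT.
Qed.
End PolySign.

(** * The two competing graphs *)
Lemma card_ord_lt n c : c <= n -> #|[set x : 'I_n | x < c]| = c.
Proof.
move=> cn; rewrite -sum1_card (eq_bigl (fun x : 'I_n => x < c)); last first.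
  by move=> x; rewrite inE.
by rewrite (big_ord_narrow cn) sum1_card card_ord.
Qed.

(** The complete graph on the vertices 0, ..., b.+1 minus one edge, with
    n - b.+2 isolated vertices: among pairs of distinct vertices at most b.+1,
    only b and b.+1 have sum b.*2.+1. *)
Definition almost_complete_adj n b : rel 'I_n :=
  fun x y => [&& x != y, x <= b.+1, y <= b.+1 & x + y != b.*2.+1].

Lemma almost_complete_sym n b : symmetric (@almost_complete_adj n b).
Proof.
move=> x y; rewrite /almost_complete_adj eq_sym addnC.
by congr (_ && _); rewrite andbCA.
Qed.

Lemma almost_complete_irrefl n b : irreflexive (@almost_complete_adj n b).
Proof. by move=> x; rewrite /almost_complete_adj eqxx. Qed.

Definition almost_complete n b : sgraph :=
  SGraph (@almost_complete_sym n b) (@almost_complete_irrefl n b).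

(** Delete the vertex b.+1: the others form a b.+1-clique, b of whose vertices
    are its neighbours. *)
Lemma clique_count_almost_complete n b j : b.+2 <= n -> 0 < j ->
  clique_count j.+1 [set: almost_complete n b] = 'C(b.+1, j.+1) + 'C(b, j).
Proof.
move=> bn j0; pose S : {set almost_complete n b} := [set x : 'I_n | x < b.+2].
rewrite (@clique_count_isolated _ _ _ S) ?subsetT //; last first.
  move=> v; rewrite !inE andbT => vb; apply/setP => u; rewrite !inE /=.
  by apply/and4P => -[]; lia.
pose y : almost_complete n b := Ordinal bn.
have yS : y \in S by rewrite inE.
rewrite (clique_count_delete _ yS).
have eC : S :\ y = [set x : 'I_n | x < b.+1].
  by apply/setP => x; rewrite !inE -val_eqE /=; lia.
have eN : S :&: nbr y = [set x : 'I_n | x < b].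
  apply/setP => x; rewrite !inE /= /almost_complete_adj -val_eqE /=; lia.
rewrite !clique_count_complete.
- by rewrite eC eN; congr ('C(_, _) + 'C(_, _)); apply: card_ord_lt; lia.
- move=> u v; rewrite eN !inE => ub vb uv.
  by rewrite /= /almost_complete_adj uv /=; lia.
- move=> u v; rewrite eC !inE => ub vb uv.
  by rewrite /= /almost_complete_adj uv /=; move: uv; rewrite -val_eqE /=; lia.
Qed.

Definition two_cliques_adj n a k : rel 'I_n := fun x y =>
  (x != y) && ((x < a) && (y < a) || (a <= x < a + k) && (a <= y < a + k)).

Lemma two_cliques_sym n a k : symmetric (@two_cliques_adj n a k).
Proof.
move=> x y; rewrite /two_cliques_adj eq_sym.
by rewrite [(x < a) && _]andbC [(a <= x < _) && _]andbC.
Qed.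

Lemma two_cliques_irrefl n a k : irreflexive (@two_cliques_adj n a k).
Proof. by move=> x; rewrite /two_cliques_adj eqxx. Qed.

Definition two_cliques n a k : sgraph :=
  SGraph (@two_cliques_sym n a k) (@two_cliques_irrefl n a k).

Section TwoCliques.
Variables n a k : nat.
Hypothesis akn : a + k <= n.
Local Notation G := (two_cliques n a k).
Let C1 : {set G} := [set x : 'I_n | x < a].
Let C2 : {set G} := [set x : 'I_n | a <= x < a + k].

Let cC1 : #|C1| = a.
Proof. by apply: card_ord_lt; lia. Qed.

Let cC12 : #|C1 :|: C2| = a + k.
Proof.
rewrite -[RHS](card_ord_lt akn); apply: eq_card => x; rewrite !inE; lia.
Qed.

Let C12 : C1 :&: C2 = set0.
Proof. by apply/setP => x; rewrite !inE; lia. Qed.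

Let cC2 : #|C2| = k.
Proof.
by have := cardsU C1 C2; rewrite cC12 cC1 C12 cards0; lia.
Qed.

Let complete1 : {in C1 &, forall x y, x != y -> adj x y}.
Proof. by move=> x y; rewrite !inE => xa ya xy; rewrite /= /two_cliques_adj xy xa ya. Qed.

Let complete2 : {in C2 &, forall x y, x != y -> adj x y}.
Proof.
by move=> x y; rewrite !inE => xa ya xy; rewrite /= /two_cliques_adj xy xa ya orbT.
Qed.

Lemma edge_count_two_cliques : clique_count 2 [set: G] = 'C(a, 2) + 'C(k, 2).
Proof.
transitivity (clique_count 2 C1 + clique_count 2 C2); last first.
  by rewrite (clique_count_complete 2 complete1) (clique_count_complete 2 complete2) cC1 cC2.
have -> : clique_count 2 [set: G] = #|cliques 2 C1 :|: cliques 2 C2|.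
  apply: eq_card => K; rewrite !inE subsetT /= -andb_orl.
  apply/idP/idP => [|/andP[]//] /andP[K2 hK]; rewrite K2 hK !andbT.
  case/cards2P: K2 hK => x [y [xy ->]] /complete_onP/(_ x y).
  rewrite !inE !eqxx orbT => /(_ isT isT xy) /andP[_].
  by rewrite !subUset !sub1set !inE.
rewrite cardsU (_ : _ :&: _ = set0) ?cards0 ?subn0 //.
apply/setP => K; rewrite !inE; apply/negP => /andP[/and3P[K1 /eqP cK _] /and3P[K2 _ _]].
have : K \subset C1 :&: C2 by rewrite subsetI K1.
by rewrite C12 subset0 -cards_eq0 cK.
Qed.

(** A k-independent set contains at most k - 1 vertices of each of the two
    cliques. *)
Lemma k_independent_two_cliques (A : {set G}) :
  k_independent k A -> #|A| + a + 2 <= n + k.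
Proof.
move=> iA; have h1 := k_independent_meet iA complete1.
have h2 := k_independent_meet iA complete2.
have hA : #|A| <= #|A :&: C1| + #|A :&: C2| + #|~: (C1 :|: C2)|.
  rewrite -(cardsID (C1 :|: C2) A) setIUr; apply: leq_add.
    by rewrite cardsU leq_subr.
  by apply: subset_leq_card; apply: subsetDr.
have : #|C1 :|: C2| + #|~: (C1 :|: C2)| = n by rewrite cardsC card_ord.
by rewrite cC12; lia.
Qed.
End TwoCliques.

(** * There is no optimally-least graph *)
Theorem theorem8 (R : realType) (k n m : nat)
    (hk : (3 <= k)%N)
    (hn : ('C(k, 2) + k + 1 <= n)%N)
    (hm : m = ('C('C(k, 2) + 2, 2) - 1)%N) :
  ~ (exists H : sgraph, optimally_least R k n m H).
Proof.
case=> H [[cH eH] opt].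
pose b := 'C(k, 2).
have kb : k.-1 <= b.
  by rewrite /b; case: (k) hk => // j _; rewrite binS bin1 leq_addl.
have mb : m = 'C(b.+1, 2) + b.
  by rewrite hm -/b addn2 binS bin1; lia.
have pos (G : sgraph) : in_S n m G ->
    forall x : R, (0 <= x -> 0 <= (k_indep_poly R k G - k_indep_poly R k H).[x])%R.
  by move=> hG x x0; rewrite hornerD hornerN subr_ge0; apply: opt.
have coefB (G : sgraph) j : ((k_indep_poly R k G - k_indep_poly R k H)`_j =
    (num_k_independent k j G)%:R - (num_k_independent k j H)%:R)%R.
  by rewrite coefB !coef_k_indep_poly.
rewrite edgesE -/(clique_count 2 _) mb in eH.
have [A iA cA] : exists2 A : {set H}, k_independent k A & #|A| + b + 2 = #|H| + k.
  apply: near_extremal_k_independent => //.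
  (* Behaviour near 0: the coefficient of degree k decreases with the number of
     k-cliques, and the lower ones are the same for all graphs of order n. *)
  pose G := almost_complete n b.
  have bn : b.+2 <= n by rewrite /b; lia.
  have hG : in_S n m G.
    split; first exact: card_ord.
    by rewrite edgesE -/(clique_count 2 _) mb clique_count_almost_complete // bin1.
  have := first_coef_ge0 _ (pos G hG).
  move/(_ k); rewrite coefB subr_ge0 ler_nat => h.
  have := num_k_independent_eq k G; have := num_k_independent_eq k H.
  rewrite cH (card_ord n : #|G| = n) -[in clique_count k [set: G]](ltn_predK hk).
  rewrite clique_count_almost_complete; [|by []|lia].
  rewrite (ltn_predK hk).
  have {}h := h _; have : num_k_independent k k H <= num_k_independent k k G.
    apply: h => i ik.
    by rewrite coefB !num_k_independent_lt // cH (card_ord n : #|G| = n) subrr.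
  lia.
(* Behaviour at infinity: A raises the degree of the polynomial of H above that
   of G, so the difference has a negative leading coefficient. *)
pose G := two_cliques n b.+1 k.
have bkn : b.+1 + k <= n by rewrite /b; lia.
have hG : in_S n m G.
  split; first exact: card_ord.
  by rewrite edgesE -/(clique_count 2 _) mb edge_count_two_cliques.
have numG j : #|A| <= j -> num_k_independent k j G = 0.
  move=> Aj; apply/eqP; rewrite cards_eq0; apply/eqP/setP => B; rewrite !inE.
  apply/negP => /andP[/(k_independent_two_cliques bkn) cB /eqP Bj].
  by move: cA cB; rewrite cH Bj; lia.
have numH : 0 < num_k_independent k #|A| H.
  by apply/card_gt0P; exists A; rewrite inE iA eqxx.
set p := (k_indep_poly R k G - k_indep_poly R k H)%R.
have pA : (p`_#|A| != 0)%R.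
  by rewrite coefB numG // sub0r oppr_eq0 pnatr_eq0 -lt0n.
have Ap : #|A| < size p.
  by rewrite ltnNge; apply: contra pA => sp; rewrite nth_default.
have : (lead_coef p <= 0)%R.
  by rewrite lead_coefE coefB numG ?sub0r ?oppr_le0 ?ler0n //; lia.
rewrite le_eqVlt ltNge lead_coef_ge0 ?orbF; last exact: pos.
by rewrite lead_coef_eq0 => /eqP p0; rewrite p0 coef0 eqxx in pA.
Qed.
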